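(* Let $\mathcal{M} \in \mathsf{Mat}_{m}(\mathbb{F}_{q})$ be superregular, let $C \in \mathsf{Mat}_{n}(\mathbb{F}_{q})$ be the companion matrix of an $n$-degree primitive polynomial $p(x)\in \mathbb{F}_q [x]$, let $\alpha \in \mathbb{F}_{q^n}$ be a root of $p(x)$, and let $M=\Psi^{-1}(\mathcal{M} \otimes C) \in \mathsf{Mat}_{m}(\mathbb{F}_{q^n})$, which is a superregular matrix. Let $F\in \mathsf{Mat}_{m}(\mathbb{F}_{q^n})$ be a matrix all of whose rows are zero except for one row (in any position), which equals $(f_1, f_2, \ldots, f_m)$, where $$f_j = \sum_{i=2}^n f_{j,i}\alpha^i \in \mathbb{F}_{q^n},\qquad f_{j,i}\in\mathbb{F}_q,$$ for every $1\leq j\leq m$. Then the matrix $M + F$ is also superregular over $\mathbb{F}_{q^n}$.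
   Context: $\mathbb{F}_q$ is the finite field with $q$ elements, $q$ a prime power. A matrix over a field is superregular if every square submatrix of it (of any size, obtained by choosing arbitrary rows and equally many arbitrary columns) is non-singular. $\mathsf{Mat}_m$ denotes $m\times m$ matrices. $A\otimes B$ is the Kronecker product, i.e. the block matrix whose $(i,j)$ block is $a_{ij}B$. A primitive polynomial of degree $n$ over $\mathbb{F}_q$ is the minimal polynomial over $\mathbb{F}_q$ of a primitive element (generator of the multiplicative group) of $\mathbb{F}_{q^n}$. Let $\langle C\rangle=\{O,I_n,C,C^2,\ldots,C^{q^n-2}\}=\mathbb{F}_q[C]$, which is a field. The map $\psi:\mathbb{F}_{q^n}\to\langle C\rangle$ with $\psi(\alpha)=C$ is the field isomorphism sending $\alpha^k$ to $C^k$ and $0$ to $O$ (so $a\in\mathbb{F}_q$ goes to $aI_n$). It is extended entrywise to matrices: $\Psi([a_{ij}])=[\psi(a_{ij})]$, a bijection from matrices over $\mathbb{F}_{q^n}$ onto matrices of the same size over $\langle C\rangle$. The matrix $\mathcal{M}\otimes C$, whose $n\times n$ blocks lie in $\langle C\rangle$, is viewed as an $m\times m$ matrix over $\langle C\rangle$. *)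

(* Defs.v *)
From HB Require Import structures.
From mathcomp Require Import all_boot all_order all_algebra all_fingroup.
From mathcomp Require Import all_solvable all_field.
From mathcomp Require Import mxtens.

Set Implicit Arguments.
Unset Strict Implicit.
Unset Printing Implicit Defensive.

Import GRing.Theory.
Local Open Scope ring_scope.

(* Submatrices are selected by strictly increasing index maps; the empty
   submatrix (k = 0) is allowed and is harmless, its determinant being 1. *)
Definition superregular (K : fieldType) (m : nat) (A : 'M[K]_m) : Prop :=
  forall (k : nat) (f g : 'I_k -> 'I_m),
    {homo f : i j / (i < j)%N} -> {homo g : i j / (i < j)%N} ->
    mxsub f g A \in unitmx.

Section Extension.
Variables (Fq : finFieldType) (L : fieldExtType Fq).

(* [finvect_type L] is the carrier of L with its finite field structure. *)
Definition primitive_element (b : L) : Prop :=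
  exists2 u : {unit finvect_type L},
    FinRing.uval u = b & generator [set: {unit finvect_type L}] u.

(* The library's qfpoly.primitive_poly is phrased instead through the order of
   'X in {poly %/ p}. *)
Definition primitive_polynomial (p : {poly Fq}) : Prop :=
  exists2 b : L,
    primitive_element b & minPoly 1%AS b = map_poly (in_alg L) p.

Variables (n : nat) (alpha : L) (C : 'M[Fq]_n).

(* alpha ^+ k |-> C ^+ k for 0 <= k <= #|Fq| ^ \dim L - 2, and 0 |-> 0, when
   alpha is a primitive element; the exponent k is then unique. *)
Definition psi (x : L) : 'M[Fq]_n :=
  if [pick k : 'I_(#|Fq| ^ \dim {:L}).-1 | x == alpha ^+ k] is Some k
  then C ^+ k else 0.

(* The value outside the image of psi is irrelevant. *)
Definition psi_inv (B : 'M[Fq]_n) : L :=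
  odflt 0 [pick x : finvect_type L | psi x == B].

Definition Psi_inv (m : nat) (A : 'M['M[Fq]_n]_m) : 'M[L]_m :=
  map_mx psi_inv A.

End Extension.

Definition mxblocks (R : Type) (m n : nat) (A : 'M[R]_(m * n)) :
  'M['M[R]_n]_m :=
  \matrix_(i, j) \matrix_(k, l) A (mxtens_index (i, k)) (mxtens_index (j, l)).

(* Main.v *)
Require Import Defs.
From mathcomp Require Import all_boot all_order all_algebra all_fingroup.
From mathcomp Require Import all_solvable all_field.
From mathcomp Require Import mxtens.

Set Implicit Arguments.
Unset Strict Implicit.
Unset Printing Implicit Defensive.

Import GRing.Theory.
Local Open Scope ring_scope.

(** The idea is to count degrees in alpha. Write q for the cardinal of Fq.
    Since psi is a field isomorphism fixing scalars, the block c C of the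
    Kronecker product comes from c alpha, so M = alpha cM: it is a nonzero
    multiple of a superregular matrix, with entries viewed in L. The perturbing
    row starts at alpha ^ 2, so one factor alpha can still be taken out of it
    and M + F = alpha P(alpha), where P is the matrix over Fq[X] which differs
    from cM only in one row, whose entries have degree at most n - 1 and
    constant term given by cM.

    A minor of P is linear in that row and constant in the others, so it is a
    polynomial over Fq of degree at most n - 1 [size_det_one_row]; its constant
    term is the corresponding minor of cM, which is nonzero. The minimal
    polynomial p of alpha has degree n, so such a polynomial cannot vanish at
    alpha [superregular_map_horner].

    Most of the remaining work is to recover M = alpha cM from the definition
    of psi as a discrete exponential. The point is that psi agrees with
    g(alpha) |-> g(C) on all polynomials g over Fq [psi_horner]. Two facts
    give this. First, g(alpha) = 0, g(C) = 0 and p | g are equivalent: alpha is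
    a root of the irreducible p, and p(C) = 0 by Cayley-Hamilton. Secondly,
    every nonzero element of L is some alpha ^ k with k < q ^ n - 1. The
    hypothesis provides this only for some root b of p, possibly another
    conjugate, but the equation g(b) = b ^ k says that p divides g - X ^ k, and
    so it transfers to alpha. *)

Local Notation "g ^[ L ]" := (map_poly (in_alg L) g)
  (at level 2, format "g ^[ L ]") : ring_scope.

Lemma homo_ltn_ord_inj (k m : nat) (f : 'I_k -> 'I_m) :
  {homo f : i j / (i < j)%N} -> injective f.
Proof.
move=> f_homo i j eq_f; apply: val_inj => /=.
by case: (ltngtP i j) => // /f_homo; rewrite eq_f ltnn.
Qed.

Lemma superregularZ (K : fieldType) (m : nat) (a : K) (A : 'M[K]_m) :
  a != 0 -> superregular A -> superregular (a *: A).
Proof.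
move=> a_neq0 A_sr k f g f_homo g_homo.
have ->: mxsub f g (a *: A) = a *: mxsub f g A.
  by apply/matrixP=> i j; rewrite !mxE.
by rewrite unitmxZ ?unitfE // A_sr.
Qed.

(** In the Leibniz expansion every product takes one entry from each row, so
    only the row selected by s contributes to the degree. The predicate s may
    also be empty: a square submatrix can miss the distinguished row. *)
Lemma size_det_one_row (K : fieldType) (k d : nat) (P : 'M[{poly K}]_k)
    (s : pred 'I_k) :
    (forall i i', s i -> s i' -> i = i') ->
    (forall i j, (size (P i j) <= 1 + (if s i then d else 0))%N) ->
  (size (\det P) <= d.+1)%N.
Proof.
move=> s_uniq size_P; apply: (leq_trans (size_sum _ _ _)).
apply/bigmax_leqP => t _.
have -> (q : {poly K}) (e : bool) : size ((-1) ^+ e * q) = size q.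
  by rewrite mulr_sign; case: e; rewrite ?size_polyN.
apply: (leq_trans (size_poly_prod_leq _ _)).
rewrite card_ord leq_subLR addnS ltnS.
apply: (@leq_trans (\sum_(i < k) (1 + (if s i then d else 0)))%N).
  by apply: leq_sum => i _; apply: size_P.
rewrite big_split /= sum1_card card_ord leq_add2l -big_mkcond sum_nat_const.
rewrite -[leqRHS]mul1n leq_mul2r orbC; apply/orP; left.
by apply/card_le1_eqP => i i' si si'; apply: s_uniq.
Qed.

(** The minors of P(a) are the values at a of polynomials of degree at most d
    whose constant terms are the nonzero minors of P(0); hence it is enough
    that a is not a root of a nonzero polynomial of degree at most d. *)
Lemma superregular_map_horner (F : fieldType) (L : fieldExtType F)
    (m d : nat) (r : 'I_m) (P : 'M[{poly F}]_m) (a : L) :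
    superregular (map_mx (horner_eval 0) P) ->
    (forall i j, (size (P i j) <= 1 + (if i == r then d else 0))%N) ->
    (forall g : {poly F}, (size g <= d.+1)%N -> root g^[L] a -> g = 0) ->
  superregular (map_mx (fun g : {poly F} => g^[L].[a]) P).
Proof.
move=> P0_sr size_P indep_a k f g f_homo g_homo.
pose Q := mxsub f g P.
rewrite unitmxE unitfE.
have <-: (\det Q)^[L].[a]
    = \det (mxsub f g (map_mx (fun h : {poly F} => h^[L].[a]) P)).
  rewrite -map_mxsub -/Q -/(horner_eval a _) -!det_map_mx; congr (\det _).
  by apply/matrixP=> i j; rewrite !mxE.
apply/negP=> /(indep_a (\det Q)) Q0.
have /negP[] : (\det Q).[0] != 0.
  rewrite -/(horner_eval 0 _) -det_map_mx map_mxsub -unitfE -unitmxE.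
  exact: P0_sr.
rewrite Q0 ?horner0 //.
apply: (@size_det_one_row _ _ _ _ (fun i => f i == r)).
  move=> i i' /eqP fi /eqP fi'.
  by apply: (homo_ltn_ord_inj f_homo); rewrite fi fi'.
by move=> i j; rewrite !mxE size_P.
Qed.

Section MinimalPolynomial.

Variables (F : fieldType) (L : fieldExtType F) (b : L) (p : {poly F}).
Hypothesis minPoly_b : minPoly 1 b = p^[L].

Lemma dvdp_root_minPoly g : root g^[L] b = (p %| g).
Proof.
rewrite -(dvdp_map (in_alg L)) -minPoly_b; apply/idP/idP => [rb|].
  by apply: (@minPoly_dvdp _ _ 1%AS) => //; apply/polyOver1P; exists g.
by move=> /dvdpP[h ->]; rewrite rootM (root_minPoly 1%AS) orbT.
Qed.

(** This is the irreducibility of p over F, descended from [minPoly_irr], which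
    concerns polynomials over L with coefficients in the image of F. *)
Lemma dvdp_minPoly_nonconst (g : {poly F}) :
  g %| p -> (size g != 1)%N -> p %| g.
Proof.
move=> g_dvd size_g.
have g_over : g^[L] \is a polyOver 1%AS by apply/polyOver1P; exists g.
have := @minPoly_irr _ _ 1%AS b _ g_over.
rewrite minPoly_b dvdp_map => /(_ g_dvd)/orP[/andP[_]|].
  by rewrite dvdp_map.
by rewrite -size_poly_eq1 size_map_poly (negPf size_g).
Qed.

Lemma minPoly_root (a : L) : root p^[L] a -> minPoly 1 a = p^[L].
Proof.
move=> root_a.
have p_monic : p^[L] \is monic by rewrite -minPoly_b monic_minPoly.
have /polyOver1P[g Dg] := minPolyOver 1%AS a.
have g_dvd : g %| p.
  rewrite -(dvdp_map (in_alg L)) -Dg minPoly_dvdp //.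
  by apply/polyOver1P; exists p.
have size_g : size g != 1%N.
  by rewrite -(size_map_poly (in_alg L)) -Dg size_minPoly.
apply/eqP; rewrite -eqp_monic ?monic_minPoly // Dg.
by rewrite /eqp !dvdp_map g_dvd dvdp_minPoly_nonconst.
Qed.

(** The minimal polynomial of the matrix C is a nonconstant divisor of the
    irreducible p, hence p divides it. *)
Lemma horner_mx_eq0 n (C : 'M[F]_n.+1) :
  horner_mx C p = 0 -> forall g, (horner_mx C g == 0) = (p %| g).
Proof.
move=> Cp0 g; apply/eqP/idP=> [Cg0|/dvdpP[h ->]]; last first.
  by rewrite rmorphM /= Cp0 mulr0.
apply: dvdp_trans (mxminpoly_min Cg0).
rewrite dvdp_minPoly_nonconst ?mxminpoly_min // size_mxminpoly.
by rewrite eqSS -lt0n mxminpoly_nonconstant.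
Qed.

End MinimalPolynomial.

Lemma companionmx_cast_root (K : fieldType) (p : {poly K}) (n : nat)
    (e : (size p).-1 = n.+1) :
  p \is monic -> horner_mx (castmx (e, e) (companionmx p)) p = 0.
Proof.
move=> p_monic.
have char_cast k (e' : (size p).-1 = k) :
  char_poly (castmx (e', e') (companionmx p)) = p.
  by case: _ / e'; rewrite castmx_id companionmxK.
by have := Cayley_Hamilton (castmx (e, e) (companionmx p)); rewrite char_cast.
Qed.

Lemma primitive_element_exp (Fq : finFieldType) (L : fieldExtType Fq)
    (b x : L) :
  primitive_element b -> x != 0 ->
  exists2 k : nat, (k < (#|Fq| ^ \dim {:L}).-1)%N & x = b ^+ k.
Proof.
case=> u <- gen_u x_neq0.
have ux : (x : finvect_type L) \is a GRing.unit by rewrite unitfE.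
have := in_setT (FinRing.unit (finvect_type L) ux).
rewrite (eqP gen_u) => /cyclePmin[k k_lt Dx]; exists k.
  move: k_lt; rewrite orderE -(eqP gen_u) card_finField_unit.
  by rewrite -(@card_vspacef Fq (finvect_type L) (Vector.class _)) card_vspace.
rewrite -[x]/(FinRing.uval (FinRing.unit (finvect_type L) ux)).
by rewrite Dx FinRing.val_unitX.
Qed.

Section Psi.

Variables (Fq : finFieldType) (L : fieldExtType Fq) (p : {poly Fq}).
Hypothesis p_prim : primitive_polynomial L p.
Variables (n : nat) (alpha : L) (C : 'M[Fq]_n.+1).
Hypothesis minPoly_alpha : minPoly 1 alpha = p^[L].
Hypothesis Cp0 : horner_mx C p = 0.

(** The exponent k is read off from the primitive root b of p: as
    g(b) = b ^ k, the minimal polynomial p of b divides g - X ^ k, whichever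
    root of p alpha is. *)
Lemma root_exp (g : {poly Fq}) : g^[L].[alpha] != 0 ->
  exists2 k : nat, (k < (#|Fq| ^ \dim {:L}).-1)%N & p %| g - 'X^k.
Proof.
case: p_prim => b b_prim minPoly_b g_neq0.
have [|k k_lt Dg] := @primitive_element_exp _ _ b g^[L].[b] b_prim.
  move: g_neq0; rewrite -!rootE (dvdp_root_minPoly minPoly_alpha).
  by rewrite (dvdp_root_minPoly minPoly_b).
exists k => //; rewrite -(dvdp_root_minPoly minPoly_b).
by rewrite rootE rmorphB /= map_polyXn hornerD hornerN hornerXn Dg subrr.
Qed.

(** Evaluation at the matrix and evaluation at alpha kill the same polynomials,
    the multiples of p; this is what makes g(alpha) |-> g(C) well defined and
    injective. *)
Lemma horner_mx_eq g h :
  (horner_mx C g == horner_mx C h) = (g^[L].[alpha] == h^[L].[alpha]).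
Proof.
rewrite -subr_eq0 -rmorphB (horner_mx_eq0 minPoly_alpha Cp0).
rewrite -(dvdp_root_minPoly minPoly_alpha) rootE rmorphB hornerD hornerN.
by rewrite subr_eq0.
Qed.

(** The exponent picked by psi satisfies g(alpha) = alpha ^ k, which forces
    g(C) = C ^ k; if there is no such exponent then g(alpha) = 0, and so
    g(C) = 0, the value that psi takes by default. *)
Lemma psi_horner g : psi alpha C g^[L].[alpha] = horner_mx C g.
Proof.
have evX k : ('X^k)^[L].[alpha] = alpha ^+ k by rewrite map_polyXn hornerXn.
have mxX k : horner_mx C 'X^k = C ^+ k by rewrite rmorphXn /= horner_mx_X.
rewrite /psi; case: pickP => [k /eqP Dk|no_k].
  by apply/eqP; rewrite -mxX horner_mx_eq evX Dk.
have [g0|g_neq0] := eqVneq g^[L].[alpha] 0.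
  apply/eqP; rewrite -(rmorph0 (horner_mx C)) horner_mx_eq.
  by rewrite rmorph0 horner0 g0.
have [k k_lt] := root_exp g_neq0.
rewrite -(dvdp_root_minPoly minPoly_alpha) rootE rmorphB hornerD hornerN.
by rewrite subr_eq0 evX (no_k (Ordinal k_lt)).
Qed.

Lemma psi_inv_horner g : <<1; alpha>>%VS = {:L}%VS ->
  psi_inv alpha C (horner_mx C g) = g^[L].[alpha].
Proof.
move=> full_alpha; rewrite /psi_inv; case: pickP => [x|/(_ g^[L].[alpha])].
  have /Fadjoin1_polyP[h ->] : (x : L) \in <<1; alpha>>%VS.
    by rewrite full_alpha memvf.
  by rewrite psi_horner horner_mx_eq => /eqP.
by rewrite psi_horner eqxx.
Qed.

End Psi.

Theorem theorem8 (Fq : finFieldType) (m n : nat)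
    (cM : 'M[Fq]_m) (cM_sr : superregular cM)
    (L : fieldExtType Fq) (dimL : \dim {:L} = n)
    (p : {poly Fq}) (p_prim : primitive_polynomial L p) (deg_p : (size p).-1 = n)
    (C : 'M[Fq]_n) (C_def : C = castmx (deg_p, deg_p) (companionmx p))
    (alpha : L) (alpha_root : root (map_poly (in_alg L) p) alpha)
    (M : 'M[L]_m) (M_def : M = Psi_inv alpha C (mxblocks (cM *t C))) :
  superregular M /\
  forall (F : 'M[L]_m) (r : 'I_m) (f : 'I_m -> nat -> Fq),
    (forall i : 'I_m, i != r -> row i F = 0) ->
    row r F = \row_(j < m) (\sum_(2 <= i < n.+1) f j i *: alpha ^+ i) ->
    superregular (M + F).
Proof.
have [b b_prim minPoly_b] := p_prim.
have minPoly_alpha := minPoly_root minPoly_b alpha_root.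
have p_monic : p \is monic.
  by rewrite -(map_monic (in_alg L)) -minPoly_b monic_minPoly.
have degA : adjoin_degree 1 alpha = n.
  by rewrite -[LHS]/(_.+1.-1) -size_minPoly minPoly_alpha size_map_poly deg_p.
have alpha_neq0 : alpha != 0.
  apply/eqP => a0.
  have: p %| 'X.
    by rewrite -(dvdp_root_minPoly minPoly_alpha) map_polyX rootE hornerX a0.
  rewrite -(dvdp_root_minPoly minPoly_b) map_polyX rootE hornerX.
  case: b_prim => u <- _; apply/negP.
  by rewrite -(@unitfE (finvect_type L)) (valP u).
(* horner_mx needs a positive size, and n is the dimension of a field. *)
case: n => [|n] in dimL deg_p C C_def M_def degA *.
  by have := adim_gt0 {:L}%AS; rewrite dimL.
have Cp0 : horner_mx C p = 0 by rewrite C_def companionmx_cast_root.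
have full_alpha : <<1; alpha>>%VS = {:L}%VS.
  apply/eqP; rewrite eqEdim subvf dimL.
  by rewrite dim_Fadjoin dimv1 muln1 degA leqnn.
have {}M_def : M = alpha *: map_mx (in_alg L) cM.
  apply/matrixP=> i j; rewrite M_def !mxE.
  have -> : \matrix_(k, l) (cM *t C) (mxtens_index (i, k)) (mxtens_index (j, l))
      = horner_mx C (cM i j *: 'X).
    by apply/matrixP=> k l; rewrite mxE tensmxE linearZ /= horner_mx_X mxE.
  rewrite (psi_inv_horner p_prim) // linearZ /= hornerZ map_polyX hornerX.
  by rewrite mulrC.
rewrite M_def; split=> [|F r f F_row' F_row].
  apply: superregularZ => // k f g f_homo g_homo.
  by rewrite -map_mxsub map_unitmx cM_sr.
(* The shift of the exponents accounts for the factor alpha taken out. *)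
pose q j : {poly Fq} := \sum_(1 <= e < n.+1) f j e.+1 *: 'X^e.
pose P := \matrix_(i, j) ((cM i j)%:P + (if i == r then q j else 0)).
have ->: alpha *: map_mx (in_alg L) cM + F
    = alpha *: map_mx (fun g : {poly Fq} => g^[L].[alpha]) P.
  apply/matrixP=> i j; rewrite !mxE rmorphD /= map_polyC /= hornerD hornerC.
  rewrite mulrDr; congr (_ + _); have [->|i_neq] := eqVneq.
    move/rowP/(_ j): F_row; rewrite !mxE => ->.
    rewrite big_add1 /= rmorph_sum horner_sum mulr_sumr; apply: eq_bigr => e _.
    rewrite /= map_polyZ map_polyXn hornerZ hornerXn exprS mulrCA.
    by rewrite -scalerAl mul1r.
  by move/rowP/(_ j): (F_row' i i_neq); rewrite !mxE rmorph0 horner0 mulr0.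
apply: superregularZ => //; apply: (@superregular_map_horner _ _ _ n r).
- have ->: map_mx (horner_eval 0) P = cM => //.
  apply/matrixP=> i j; rewrite !mxE /horner_eval hornerD hornerC.
  case: eqP => _; last by rewrite horner0 addr0.
  rewrite horner_sum big_nat big1 ?addr0 // => -[//|e] _.
  by rewrite hornerZ hornerXn expr0n mulr0.
- move=> i j; rewrite mxE (leq_trans (size_polyD _ _)) // geq_max.
  rewrite (leq_trans (size_polyC_leq1 _)) ?leq_addr //=.
  case: eqP => _; last by rewrite size_poly0.
  rewrite /q big_nat (leq_trans (size_sum _ _ _)) //.
  apply/bigmax_leqP_seq => e _ /andP[_ e_lt].
  by rewrite (leq_trans (size_scale_leq _ _)) // size_polyXn add1n.
move=> g size_g; rewrite (dvdp_root_minPoly minPoly_alpha) => p_dvd.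
apply/eqP/contraT => g_neq0.
have := leq_trans (dvdp_leq g_neq0 p_dvd) size_g.
by rewrite leqNgt -deg_p prednK ?leqnn // size_poly_gt0 monic_neq0.
Qed.
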